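(* Let $X$ be a Tychonoff space. Then the following properties of the space $C_p(X)$ are equivalent: the $\Omega$-Ramsey property; the Ramsey property; property $\alpha_2$; property $\alpha_4$.
   Context: $C_p(X)$ is the topological group of all real-valued continuous functions on $X$ with the topology of pointwise convergence. The properties below are defined for a Hausdorff space $Y$. Ramsey property: for any points $x_{i,j}\in Y$ ($i,j\in\omega$) such that for each $i$ the sequence $(x_{i,j})_{j\in\omega}$ converges to a point $x_i\in Y$ and the sequence $(x_i)_{i\in\omega}$ converges to a point $x\in Y$, there is an infinite $M\subseteq\omega$ such that for every open neighborhood $U$ of $x$ there is $k\in\omega$ with $x_{m,n}\in U$ for all $m,n\in M$ with $k\le m<n$. $\Omega$-Ramsey property: for any finite sets $T_{i,j}\subseteq Y$ ($i,j\in\omega$) and points $x_i,x\in Y$ such that for each $i$ every neighborhood of $x_i$ contains $T_{i,j}$ for all but finitely many $j$, and the sequence $(x_i)_{i\in\omega}$ converges to $x$, there is an infinite $M\subseteq\omega$ such that for every open neighborhood $U$ of $x$ there is $k\in\omega$ with $T_{m,n}\subseteq U$ for all $m,n\in M$ with $k\le m<n$. For $x\in Y$ let $\Gamma_x$ be the family of all infinite sets $A\subseteq Y$ with $x\notin A$ such that $A\setminus U$ is finite for every neighborhood $U$ of $x$. $Y$ has property $\alpha_2$ if for every $x\in Y$ it satisfies $S_1(\Gamma_x,\Gamma_x)$: for each sequence $(A_n)_{n\in\omega}$ of elements of $\Gamma_x$ there are $b_n\in A_n$ with $\{b_n:n\in\omega\}\in\Gamma_x$. $Y$ has property $\alpha_4$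 if for every $x\in Y$ it satisfies $S_{\mathrm{fin}}(\Gamma_x,\Gamma_x)$: for each sequence $(A_n)_{n\in\omega}$ of elements of $\Gamma_x$ there are finite $B_n\subseteq A_n$ with $\bigcup_n B_n\in\Gamma_x$. *)

(* Defs.v *)
From HB Require Import structures.
From mathcomp Require Import all_boot all_order all_algebra.
From mathcomp Require Import all_classical all_reals all_analysis.

Set Implicit Arguments.
Unset Strict Implicit.
Unset Printing Implicit Defensive.

Import numFieldNormedType.Exports.

Local Open Scope classical_set_scope.

Definition tychonoff_space (X : topologicalType) : Prop :=
  hausdorff_space X /\ completely_regular_space X.

(* [C_p(X)]: the continuous functions [X -> R] with the topology inherited from
   the product [R^X]. A separate name is needed because [continuousType X R] has
   no canonical topology in the library. *)
Definition Cp (R : realType) (X : topologicalType) : Type :=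
  continuousType X R.

HB.instance Definition _ (R : realType) (X : topologicalType) :=
  Topological.copy (Cp R X)
    (initial_topology
       ((fun f => f : X -> R) : continuousType X R -> {ptws X -> R})).

Definition Ramsey_property (Y : topologicalType) : Prop :=
  forall (x_ : nat -> nat -> Y) (y : nat -> Y) (x : Y),
    (forall i, x_ i @ \oo --> y i) ->
    y @ \oo --> x ->
    exists M : set nat, infinite_set M /\
      forall U : set Y, open_nbhs x U ->
        exists k : nat, forall m n : nat,
          M m -> M n -> (k <= m < n)%N -> U (x_ m n).

Definition Omega_Ramsey_property (Y : topologicalType) : Prop :=
  forall (T : nat -> nat -> set Y) (y : nat -> Y) (x : Y),
    (forall i j, finite_set (T i j)) ->
    (forall i (U : set Y), nbhs (y i) U ->
       finite_set [set j | ~ (T i j `<=` U)]) ->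
    y @ \oo --> x ->
    exists M : set nat, infinite_set M /\
      forall U : set Y, open_nbhs x U ->
        exists k : nat, forall m n : nat,
          M m -> M n -> (k <= m < n)%N -> T m n `<=` U.

Definition Gamma (Y : topologicalType) (x : Y) : set (set Y) :=
  [set A | [/\ infinite_set A, ~ A x &
               forall U : set Y, nbhs x U -> finite_set (A `\` U)]].

Definition S_1 (T : Type) (F G : set (set T)) : Prop :=
  forall A : nat -> set T, (forall n, F (A n)) ->
    exists b : nat -> T, (forall n, A n (b n)) /\ G (range b).

Definition S_fin (T : Type) (F G : set (set T)) : Prop :=
  forall A : nat -> set T, (forall n, F (A n)) ->
    exists B : nat -> set T,
      (forall n, finite_set (B n) /\ B n `<=` A n) /\ G (\bigcup_n B n).

Definition property_alpha2 (Y : topologicalType) : Prop :=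
  forall x : Y, S_1 (Gamma x) (Gamma x).

Definition property_alpha4 (Y : topologicalType) : Prop :=
  forall x : Y, S_fin (Gamma x) (Gamma x).

(* Main.v *)
Require Import Defs.
From mathcomp Require Import all_boot all_order all_algebra.
From mathcomp Require Import all_classical all_reals all_analysis.
From mathcomp Require Import lra.

Set Implicit Arguments.
Unset Strict Implicit.
Unset Printing Implicit Defensive.

Import Order.TTheory GRing.Theory Num.Theory numFieldNormedType.Exports.

Local Open Scope classical_set_scope.
Local Open Scope ring_scope.

(** The implications go around the cycle: Omega-Ramsey, Ramsey, [alpha2],
    [alpha4], and back. The first is the case of singletons, and the third
    holds in every space since singletons are finite. The other two rest on
    one construction, [envelope]. Given finite sets [T l j] of continuous
    functions with [T l j] converging to [y l] as [j] grows, let [u i j] be the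
    pointwise maximum of all [|y l - t|] with [l <= i] and [t] in [T l j],
    and of the constant [1/(j+1)]. Each [u i j] is continuous and positive,
    [u i j] tends to [0] pointwise as [j] grows, and a single [u i j]
    controls the [j]-th entries of all the rows [0, ..., i] at once.

    Ramsey implies [alpha2]. Let each row enumerate part of a set [A l] and
    converge to [f], and apply the Ramsey property to [u], whose rows
    all converge to [0]. It gives an infinite [M] with [u m n] small whenever
    [m < n] are large elements of [M]. For every [l] pick such [m < n] with
    [l <= m]. The [n]-th entry of row [l] is within [u m n] of [f], so the
    entries picked, one in every row, converge to [f].

    [alpha4] implies Omega-Ramsey. Applied to tails of the rows of [u],
    [alpha4] yields indices [i k < j k] with [i k] tending to infinity and
    [u (i k) (j k)] tending to [0] ([alpha4_select]). Pass to a subsequence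
    such that [j k <= i k'] for consecutive terms [k], [k'], and let [M] be
    the set of the remaining [j k]. If [m < n] are in [M], then [n = j k]
    with [m <= i k], hence every [t] in [T m n] is within [u (i k) (j k)] of
    [y m]; as [y m] tends to [x], so does [t]. *)

(** * Infinite sets and sequences *)

Lemma infinite_set_enum (T : Type) (A : set T) :
  infinite_set A -> exists e : nat -> T, injective e /\ forall n, A (e n).
Proof.
move=> /infiniteP/card_leP[f].
exists (fun n => set_val (f (exist _ n (mem_set I)))); split=> [m n|n].
  move=> /val_inj /(inj (f := f)); rewrite !in_setT => /(_ isT isT).
  by move=> /(congr1 val).
exact: set_valP.
Qed.

Lemma near_cofinite (P : set nat) :
  finite_set (~` P) <-> \forall n \near \oo, P n.
Proof.
split=> [/finite_seqP[s sP]|[N _ NP]]; last first.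
  apply: (@sub_finite_set _ _ `I_N) (finite_II N) => n /= nP.
  by rewrite ltnNge; apply/negP => /NP.
exists (\max_(i <- s) i).+1 => // n /= ltn.
apply: contrapT => nP.
have : [set` s] n by rewrite -sP.
move=> /= ns; have := @leq_bigmax_seq _ s xpredT id n ns isT.
by rewrite leqNgt ltn.
Qed.

Lemma infinite_set_unbounded (M : set nat) (N : nat) :
  infinite_set M -> exists2 m, M m & (N <= m)%N.
Proof.
move=> Minf; apply: contrapT => nM; apply: Minf.
apply: (@sub_finite_set _ _ `I_N) (finite_II N) => m /= Mm.
by rewrite ltnNge; apply/negP => Nm; apply: nM; exists m.
Qed.

(** * The families Gamma_x and convergent sequences *)

Section Gamma_sequences.
Context {Y : topologicalType}.

Lemma Gamma_enum (x : Y) (A : set Y) : Gamma x A ->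
  exists a : nat -> Y, (forall n, A (a n)) /\ a @ \oo --> x.
Proof.
case=> /infinite_set_enum[a [a_inj Aa]] _ AU; exists a; split=> // U xU.
apply/near_cofinite.
apply: sub_finite_set (finite_preimage (in2W a_inj) (AU U xU)) => n nU.
by split.
Qed.

(** The range is infinite because in a T1 space a finite set is closed: if
    [b] took finitely many values, none of them [x], the complement of its
    range would be a neighborhood of [x] that [b] never enters. *)
Lemma Gamma_range (x : Y) (b : nat -> Y) : accessible_space Y ->
  b @ \oo --> x -> (forall n, b n <> x) -> Gamma x (range b).
Proof.
move=> /accessible_finite_set_closed Y1 bx bnx; split.
- move=> /Y1 clb.
  have : nbhs x (~` range b).
    apply: open_nbhs_nbhs; split; first exact: closed_openC.
    by case=> n _ /bnx.
  by move=> /bx[N _ /(_ N)] /(_ (leqnn N)); apply; exists N.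
- by case=> n _ /bnx.
- move=> U /bx /near_cofinite /(finite_image b); apply: sub_finite_set.
  by move=> _ [[n _ <-] nU]; exists n.
Qed.

End Gamma_sequences.

(** * Pointwise convergence and finite suprema in C_p(X) *)

Section Cp_basics.
Context {R : realType} {X : topologicalType}.
Implicit Types (f g : Cp R X) (p : X).

(** Stated for arbitrary filters so that it covers sequences, the neighborhood
    filter itself, and the filter implicit in the Omega-Ramsey property: the
    sets containing all [T m n] with [m < n] large elements of [M]. *)
Lemma Cp_cvgP (F : set_system (Cp R X)) f : Filter F ->
  F --> f <-> forall p e, 0 < e -> F [set g | `|f p - g p| < e].
Proof.
move=> FF; split=> [Ff p e e0|Ff].
- apply: Ff.
  have : (fun h : {ptws X -> R} => h p) @ (nbhs (f : {ptws X -> R})) --> f p.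
    have := (iffLR (pointwise_cvgP (F := nbhs (f : {ptws X -> R})) f _)); exact.
  move=> /cvgr_dist_lt /(_ e e0) fp.
  exact: (@initial_continuous _ _ ((fun f => f : X -> R) : continuousType X R -> {ptws X -> R}) f _ fp).
- move=> U.
  rewrite nbhsE => -[_ [[V Vo <-] /= fV] VU].
  apply: filterS VU _.
  have ptF : (fun g : Cp R X => g : {ptws X -> R}) @ F --> (f : {ptws X -> R}).
    apply/(pointwise_cvgP (F := (fun g : Cp R X => g : {ptws X -> R}) @ F)).
    by move=> p; apply/cvgrPdist_lt => e e0; exact: Ff.
  by apply: ptF; exact: open_nbhs_nbhs.
Qed.

Lemma nbhs_Cp f p e : 0 < e -> nbhs f [set g | `|f p - g p| < e].
Proof. by move: p e; apply/Cp_cvgP. Qed.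

Lemma Cp_accessible : accessible_space (Cp R X).
Proof.
move=> f g /eqP fg.
have /existsNP[p /eqP fgp] : ~ f =1 g by move/continuousEP.
exists (interior [set h : Cp R X | `|f p - h p| < `|f p - g p|]); split.
- exact: open_interior.
- by rewrite inE; apply: nbhs_Cp; rewrite normr_gt0 subr_eq0.
- by rewrite inE => /interior_subset /=; rewrite ltxx.
Qed.

Let dist_continuous f g : continuous (fun p => `|f p - g p|).
Proof.
move=> p; apply: cvg_norm; apply: cvgB; exact: cts_fun.
Qed.

Definition Cp_dist f g : Cp R X := mkcts (@dist_continuous f g).

Let max_continuous f g : continuous (fun p => Num.max (f p) (g p)).
Proof. by move=> p; apply: continuous_max; exact: cts_fun. Qed.

Definition Cp_max f g : Cp R X := mkcts (@max_continuous f g).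

Definition Cp_cst (c : R) : Cp R X := (cst c : continuousType X R).

(** The function [g] is the pointwise maximum of [0] and the elements of [S];
    including [0] gives a meaning to the case of an empty [S], and explains
    the restriction to nonnegative bounds [e]. *)
Lemma finite_lub (S : set (Cp R X)) : finite_set S -> exists g : Cp R X,
  forall p e, 0 <= e -> (g p <= e <-> forall f, S f -> f p <= e).
Proof.
move=> /finite_seqP[s ->]; elim: s => [|f s [g IH]].
  by exists (Cp_cst 0) => p e e0; split.
exists (Cp_max f g) => p e e0; rewrite /= /mkcts/= ge_max; split.
  move=> /andP[fe /IH ge] h /=; rewrite inE => /predU1P[->//|]; exact: ge.
move=> H; apply/andP; split; first by apply: H; rewrite /= mem_head.
by apply/IH => // h hs; apply: H; rewrite /= inE hs orbT.
Qed.

(** A maximum and not a sum: the number of elements of [T l j] may grow with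
    [j], so that the sum of the distances to [y l] need not tend to [0]. The
    bound for all rows [l <= i] at once is what lets one selected function
    [u i j] speak about many pairs of indices. Positivity at every
    point keeps [u i j] distinct from the zero function when [X] is nonempty,
    as membership in Gamma_0 demands. *)
Lemma envelope (T : nat -> nat -> set (Cp R X)) (y : nat -> Cp R X) :
  (forall l j, finite_set (T l j)) ->
  (forall l U, nbhs (y l) U -> \forall j \near \oo, T l j `<=` U) ->
  exists u : nat -> nat -> Cp R X,
    [/\ forall i, u i @ \oo --> Cp_cst 0,
        forall i j p, 0 < u i j p &
        forall l i j t p, (l <= i)%N -> T l j t -> `|y l p - t p| <= u i j p].
Proof.
move=> Tfin Ty.
pose S i j := (\bigcup_(l in `I_i.+1) (Cp_dist (y l) @` T l j))
  `|` [set Cp_cst (harmonic j)].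
have Sfin i j : finite_set (S i j).
  rewrite finite_setU; split; last exact: finite_set1.
  by apply: bigcup_finite => // l _; apply: finite_image.
pose ub (i j : nat) (g : Cp R X) :=
  forall p e, 0 <= e -> (g p <= e <-> forall f, S i j f -> f p <= e).
have /choice[v vP] (ij : nat * nat) : exists g, ub ij.1 ij.2 g.
  exact: finite_lub.
pose u i j := v (i, j); have uP i j : ub i j (u i j) := vP (i, j).
have harm_le i j p : harmonic j <= u i j p.
  (* A supremum over a set containing a positive constant is not negative. *)
  have [|u0] := ltP (u i j p) 0; last first.
    by apply: (iffLR (uP i j p _ u0) (lexx _) (Cp_cst _)); right.
  move=> /ltW u0.
  have /(_ (Cp_cst (harmonic j))) := iffLR (uP i j p 0 (lexx 0)) u0.
  move=> /(_ (or_intror erefl)).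
  by rewrite leNgt /= harmonic_gt0.
have u_gt0 i j p : 0 < u i j p by exact: lt_le_trans (harmonic_gt0 _) (harm_le _ _ _).
exists u; split=> //.
- move=> i; apply/Cp_cvgP => p e e0 /=.
  have e20 : 0 < e / 2 by rewrite divr_gt0.
  have Hd : \forall j \near \oo, forall l, (l < i.+1)%N ->
      forall t, T l j t -> `|y l p - t p| <= e / 2.
    elim: i.+1 => [|k IH]; first by near=> j.
    have Hk := Ty k _ (nbhs_Cp (y k) p e20).
    near=> j => l; rewrite ltnS leq_eqVlt => /predU1P[->|lk] t Tt.
      by apply: ltW; move: t Tt; near: j.
    by move: l lk t Tt; near: j.
  have Hh : \forall j \near \oo, harmonic j <= e / 2 :> R.
    have /cvgr0_norm_le/(_ _ e20) := @cvg_harmonic R.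
    by apply: filterS => j; apply: le_trans; exact: ler_norm.
  near=> j.
  rewrite /= sub0r normrN gtr0_norm//.
  apply: (@le_lt_trans _ _ (e / 2)); last lra.
  apply/uP; first exact: ltW.
  move=> _ [[l /= li [t Tt <-]]|->].
    rewrite /= /mkcts.
    by move: l li t Tt; near: j.
  by rewrite /=; near: j.
- move=> l i j t p li Tt.
  apply: (iffLR (uP i j p _ (ltW (u_gt0 _ _ _))) (lexx _) (Cp_dist (y l) t)).
  by left; exists l => //; exists t.
Unshelve. all: by end_near. Qed.

End Cp_basics.

(** * The four implications *)

Lemma Omega_Ramsey_Ramsey (Y : topologicalType) :
  Omega_Ramsey_property Y -> Ramsey_property Y.
Proof.
move=> OR z y x zy yx.
have [||M [Minf MP]] := OR (fun i j => [set z i j]) y x _ _ yx.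
- by move=> i j; exact: finite_set1.
- by move=> i U /(zy i) [N _ NU]; apply/near_cofinite; exists N => // j /NU zU _ ->.
exists M; split=> // U /MP[k kP]; exists k => m n Mm Mn kmn.
exact: kP kmn _ erefl.
Qed.

(** The rows [a l] have the common limit [f], so the constant sequence [f]
    serves as the limits [y l] of the envelope. *)
Lemma Ramsey_alpha2 (R : realType) (X : topologicalType) :
  Ramsey_property (Cp R X) -> property_alpha2 (Cp R X).
Proof.
move=> Ram f A Af.
have /choice[a aP] l : exists a : nat -> Cp R X,
  (forall n, A l (a n)) /\ a @ \oo --> f by exact: Gamma_enum.
have [||u [u0 _ au]] := @envelope R X (fun l j => [set a l j]) (fun=> f).
- by move=> l j; exact: finite_set1.
- move=> l U fU; have [N _ NU] := (aP l).2 _ fU.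
  by exists N => // j /NU aU _ ->.
have [|M [Minf MP]] := Ram u (fun=> Cp_cst 0) (Cp_cst 0) u0.
  exact: cvg_cst.
have /choice[mn mnP] l : exists mn : nat * nat,
    [/\ M mn.1, M mn.2, (l <= mn.1)%N & (mn.1 < mn.2)%N].
  have [m Mm lm] := infinite_set_unbounded l Minf.
  have [n Mn mn] := infinite_set_unbounded m.+1 Minf.
  by exists (m, n).
pose b l := a l (mn l).2.
have bf : b @ \oo --> f.
  apply/Cp_cvgP => p e e0.
  have [|k kP] := MP (interior [set g : Cp R X | `|Cp_cst 0 p - g p| < e]).
    by split; [exact: open_interior | exact: nbhs_Cp].
  exists k => // l /= kl; have [M1 M2 l1 l2] := mnP l.
  have /interior_subset /= := kP _ _ M1 M2 (introT andP (conj (leq_trans kl l1) l2)).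
  rewrite sub0r normrN; apply: le_lt_trans; apply: le_trans (ler_norm _).
  exact: au l1 erefl.
have Ab l : A l (b l) by exact: (aP l).1.
exists b; split=> //; apply: Gamma_range => //; first exact: Cp_accessible.
by move=> l bl; have [_ + _] := Af l; apply; rewrite -bl.
Qed.

Lemma alpha2_alpha4 (Y : topologicalType) :
  property_alpha2 Y -> property_alpha4 Y.
Proof.
move=> a2 x A /a2[b [Ab bx]]; exists (fun n => [set b n]); split.
  by move=> n; split; [exact: finite_set1 | move=> _ ->].
suff -> : \bigcup_n [set b n] = range b by [].
by rewrite eqEsubset; split=> [_ [n _ ->]|_ [n _ <-]]; exists n.
Qed.

(** The finite sets chosen by [alpha4] may be empty for many rows, but their
    union is infinite and each of them is finite; hence an injective
    enumeration of the union leaves every finite set of rows, and it converges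
    because the union is in Gamma_x. Starting row [i] at column [i+1] forces
    [i k < j k]. *)
Lemma alpha4_select (Y : topologicalType) (x : Y) (u : nat -> nat -> Y) :
  accessible_space Y -> S_fin (Gamma x) (Gamma x) ->
  (forall i, u i @ \oo --> x) -> (forall i j, u i j <> x) ->
  exists i j : nat -> nat, [/\ forall k, (i k < j k)%N,
    i @ \oo --> \oo & (fun k => u (i k) (j k)) @ \oo --> x].
Proof.
move=> Y1 Sfin ux unx.
pose A i := range (fun j => u i (i.+1 + j)%N).
have AG i : Gamma x (A i).
  apply: Gamma_range => // U /(ux i) [N _ NU].
  exists N => // j /= Nj; apply: NU => /=; exact: leq_trans Nj (leq_addl _ _).
have [B [BA [/infinite_set_enum[e [e_inj eB]] _ Bx]]] := Sfin A AG.
have /choice[i iP] k : exists i, B i (e k) by have [i _ ?] := eB k; exists i.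
have /choice[j jP] k : exists j, u (i k) ((i k).+1 + j)%N = e k.
  by have [j _ <-] := (BA (i k)).2 _ (iP k); exists j.
exists i, (fun k => (i k).+1 + j k)%N; split.
- by move=> k; rewrite leq_addr.
- move=> V [N _ NV]; apply/near_cofinite.
  have : finite_set (\bigcup_(l in `I_N) B l).
    by apply: bigcup_finite => // l _; exact: (BA l).1.
  move=> /(finite_preimage (in2W e_inj)).
  apply: sub_finite_set => k /= nV; exists (i k) => //=.
  by rewrite ltnNge; apply/negP => /NV.
- under eq_cvg do rewrite jP.
  move=> U /Bx /(finite_preimage (in2W e_inj)) fin.
  by apply/near_cofinite; apply: sub_finite_set fin => k /= nU; split.
Qed.

Lemma alpha4_Omega_Ramsey (R : realType) (X : topologicalType) :
  property_alpha4 (Cp R X) -> Omega_Ramsey_property (Cp R X).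
Proof.
move=> a4 T y x Tfin Ty yx.
(* Over an empty [X] the envelope equals its limit and gives no element of
   Gamma_0, but then all the functions coincide. *)
have [[p0 _]|X0] := pselect (exists p : X, True); last first.
  exists setT; split; first exact: infinite_nat.
  move=> U [_ Ux]; exists 0%N => m n _ _ _ t _.
  suff -> : t = x by [].
  by apply/continuousEP => p; case: X0; exists p.
have [|u [u0 u_gt0 Tu]] := envelope Tfin (y := y).
  by move=> l U yU; apply/near_cofinite; exact: Ty.
have [|i [j [ij i_oo uij]]] := alpha4_select (@Cp_accessible R X) (a4 (Cp_cst 0)) u0.
  by move=> i j /continuousEP /(_ p0) up; have := u_gt0 i j p0; rewrite up ltxx.
(* Thin out to a subsequence along which the rows outrun the earlier columns. *)
have /choice[nxt nxtP] k : exists k', (k < k')%N /\ (j k <= i k')%N.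
  have [K _ KP] := i_oo _ (nbhs_infty_ge (j k)).
  exists (maxn k.+1 K); split; first by rewrite leq_max leqnn.
  by apply: KP; rewrite /= leq_max leqnn orbT.
pose kappa s := iter s nxt 0%N; pose J s := j (kappa s).
have kappa_ge s : (s <= kappa s)%N.
  by elim: s => // s IH; exact: leq_ltn_trans IH (nxtP _).1.
have JS s : (J s <= i (kappa s.+1))%N by exact: (nxtP _).2.
have J_inc : {mono J : s t / (s <= t)%N}.
  apply: leq_mono; apply: homo_ltn => [? ? ?|s]; first exact: ltn_trans.
  exact: leq_ltn_trans (JS s) (ij _).
have J_i s t : (s < t)%N -> (J s <= i (kappa t))%N.
  case: t => // t; rewrite ltnS => st.
  by apply: leq_trans (JS t); rewrite J_inc.
exists (range J); split.
  move=> /(finite_preimage (in2W (incn_inj J_inc))).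
  by rewrite preimage_range; exact: infinite_nat.
pose F : set_system (Cp R X) := [set P | exists k, forall m n,
   range J m -> range J n -> (k <= m < n)%N -> T m n `<=` P].
have FF : Filter F.
  split.
  - by exists 0%N.
  - move=> P Q [k kP] [l lQ]; exists (maxn k l) => m n Jm Jn.
    rewrite geq_max => /andP[/andP[km lm] mn] t Tt; split.
      by apply: kP Tt => //; rewrite km.
    by apply: lQ Tt => //; rewrite lm.
  - move=> P Q PQ [k kP]; exists k => m n Jm Jn kmn.
    exact: subset_trans (kP m n Jm Jn kmn) PQ.
suff Fx : F --> x by move=> U /open_nbhs_nbhs /Fx.
apply/Cp_cvgP => p e e0.
have e20 : 0 < e / 2 by rewrite divr_gt0.
have [N _ NP] : \forall m \near \oo, `|x p - y m p| < e / 2.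
  exact: (iffLR (Cp_cvgP _ _) yx).
have [K _ KP] : \forall k \near \oo, `|0 - u (i k) (j k) p| < e / 2.
  exact: (iffLR (Cp_cvgP _ _) uij).
exists (maxn N (J K)) => _ _ [s _ <-] [t _ <-] /andP[].
rewrite geq_max J_inc => /andP[Ns Ks]; rewrite ltnNge J_inc -ltnNge => st g Tg /=.
have H1 := NP _ Ns.
have /KP : (K <= kappa t)%N.
  exact: leq_trans (leq_trans Ks (ltnW st)) (kappa_ge t).
rewrite sub0r normrN => H2.
have H3 := Tu _ _ _ _ p (J_i _ _ st) Tg.
have H4 := ler_norm (u (i (kappa t)) (j (kappa t)) p).
have H5 := ler_distD (y (J s) p) (x p) (g p).
lra.
Qed.

Theorem theorem4p2 (R : realType) (X : topologicalType) :
  tychonoff_space X ->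
  [<-> Omega_Ramsey_property (Cp R X);
       Ramsey_property (Cp R X);
       property_alpha2 (Cp R X);
       property_alpha4 (Cp R X)].
Proof.
move=> _; tfae.
- exact: Omega_Ramsey_Ramsey.
- exact: Ramsey_alpha2.
- exact: alpha2_alpha4.
- exact: alpha4_Omega_Ramsey.
Qed.
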